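(* Let $k$ be a positive integer. (a) The $k$-ary dependence atom is not definable in the extension of first order logic by all dependence atoms of arity $<k$, all other atoms (arbitrary general atoms $\alpha_C$) of arity $<k$, all independence, exclusion, inclusion and anonymity atoms of arity $\le k$, constancy atoms, and all Lindström quantifiers. (b) The $k$-ary exclusion atom is not definable in the extension of first order logic by all exclusion, inclusion, anonymity, dependence, independence atoms of arity $<k$, constancy atoms, any other atoms (arbitrary general atoms $\alpha_C$) of arity $<k$, and all Lindström quantifiers. (c) The $k$-ary inclusion atom is not definable in the extension of first order logic by all inclusion, exclusion, anonymity, dependence atoms of arity $<k$, constancy atoms, any other atoms of arity $<k$, and all Lindström quantifiers. (d) The $k$-ary anonymity atom is not definable in the extension of first order logic by all inclusion, anonymity, exclusion, dependence atoms of arity $<k$, constancy atoms, any other atoms of arity $<k$, and all Lindström quantifiers. (e) The $k$-ary independence atom (whether pure or conditional) is not definable in the extension of first order logic by all independence, inclusion, anonymity, exclusion, dependence atoms of arity $<k$, constancy atoms, any other atoms of arity $<k$, and all Lindström quantifiers.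
   Context: Models are assumed to have at least two elements. A team $T$ in a model $M$ with domain a finite set of variables is a set of assignments from these variables to $M$. $s(a/x)$ is the assignment that agrees with $s$ except that $x\mapsto a$; $T\restriction\vec x=\{s\restriction\vec x: s\in T\}$. Team semantics. For a first-order literal $\phi$ (atomic or negated atomic formula, including equality): $M\models_T\phi$ iff every $s\in T$ satisfies $\phi$. $M\models_T\phi\wedge\psi$ iff $M\models_T\phi$ and $M\models_T\psi$. $M\models_T\phi\vee\psi$ iff $T=U\cup V$ for some $U,V$ with $M\models_U\phi$ and $M\models_V\psi$. $M\models_T\exists x\phi$ iff there is $F:T\to\mathcal P(M)\setminus\{\emptyset\}$ with $M\models_{T[F/x]}\phi$, where $T[F/x]=\{s(a/x): s\in T,a\in F(s)\}$. $M\models_T\forall x\phi$ iff $M\models_{T[M/x]}\phi$, where $T[M/x]=\{s(a/x):s\in T,a\in M\}$. Lindström quantifiers: for each positive integer $r$ and each isomorphism-closed class $\mathcal K$ of structures $(A,R)$, $R\subseteq A^r$, there is a quantifier $Q_{\mathcal K}$ binding an $r$-tuple $\vec y$ of distinct variables: $M\models_T Q_{\mathcal K}\vec y\,\psi$ iff there is $F:T\to\mathcal P(M^r)$ with $M\models_{T[F/\vec y]}\psi$ and $(M,F(s))\in\mathcal K$ for all $s\in T$, where $T[F/\vec y]=\{s(\vec b/\vec y):s\in T,\vec b\in F(s)\}$. Atoms. Dependence: $M\models_T{=}(\vec x,y)$ iff $s(\vec x)=s'(\vec x)$ implies $s(y)=s'(y)$ for all $s,s'\in T$; it is $k$-ary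 if $\mathrm{len}(\vec x)=k$. Constancy: $M\models_T{=}(\vec y)$ iff $s(\vec y)=s'(\vec y)$ for all $s,s'\in T$. Exclusion: $M\models_T\vec x\mid\vec y$ iff $s(\vec x)\neq s'(\vec y)$ for all $s,s'\in T$; $k$-ary if $\mathrm{len}(\vec x)=\mathrm{len}(\vec y)=k>0$. Inclusion: $M\models_T\vec x\subseteq\vec y$ iff for every $s\in T$ there is $s'\in T$ with $s(\vec x)=s'(\vec y)$; $k$-ary if $\mathrm{len}(\vec x)=\mathrm{len}(\vec y)=k>0$. Anonymity: $M\models_T\vec x\,\Upsilon\,y$ iff for every $s\in T$ there is $s'\in T$ with $s(\vec x)=s'(\vec x)$ and $s(y)\ne s'(y)$; $k$-ary if $\mathrm{len}(\vec x)=k>0$. Independence: $M\models_T\vec x\perp_{\vec z}\vec y$ iff for all $s,s'\in T$ with $s(\vec z)=s'(\vec z)$ there is $s''\in T$ with $s''(\vec z)=s(\vec z)$, $s''(\vec x)=s(\vec x)$, $s''(\vec y)=s'(\vec y)$ ($\vec x,\vec y$ non-empty); it is $(m+\max(p,q))$-ary if $\mathrm{len}(\vec z)=m$, $\mathrm{len}(\vec x)=p$, $\mathrm{len}(\vec y)=q$; it is called pure if $m=0$ and conditional otherwise. General atom: for a class $C$, closed under isomorphisms, of pairs $(A,S)$ with $A$ a set and $S\subseteq A^k$, the $k$-ary atom $\alpha_C(\vec x)$, $\mathrm{len}(\vec x)=k$, is given by $M\models_T\alpha_C(\vec x)$ iff $(A,T\restriction\vec x)\in C$, where $A$ is the domain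 of $M$. The extension of first order logic by a collection of atoms and quantifiers is the closure of first-order literals and the given atoms under $\wedge,\vee,\exists,\forall$ and the given quantifiers. An atom $\alpha$ (with pairwise distinct variables $\vec z$) is definable in a logic if the logic has a formula $\phi$ with free variables in $\vec z$ such that $M\models_T\alpha\iff M\models_T\phi$ for all models $M$ and all teams $T$ in $M$ with domain $\vec z$. *)

(* Defs.v *)
From mathcomp Require Import all_boot finmap classical_sets.

Set Implicit Arguments.
Unset Strict Implicit.
Unset Printing Implicit Defensive.

Local Open Scope fmap_scope.
Local Open Scope classical_set_scope.

Definition var := nat.

Record signature := Signature {
  fsym : Type;
  rsym : Type;
  far : fsym -> nat;
  rar : rsym -> nat
}.

Record model (L : signature) := Model {
  carrier :> Type;
  fun_int : forall f : fsym L, (far f).-tuple carrier -> carrier;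
  rel_int : forall R : rsym L, set ((rar R).-tuple carrier);
  two_elements : exists a b : carrier, a <> b
}.

(* An isomorphism-closed class of structures (A, S) with S a subset of A^n. *)
Record iso_class (n : nat) := IsoClass {
  in_class :> forall A : Type, set (n.-tuple A) -> Prop;
  iso_closed : forall (A B : Type) (f : A -> B) (S : set (n.-tuple A)),
    bijective f -> in_class S -> in_class [set map_tuple f b | b in S]
}.

Record lindstrom := Lindstrom {
  qar : nat;
  qar_gt0 : 0 < qar;
  qclass : iso_class qar
}.

(* Indep xs zs ys is the atom "xs is independent of ys given zs". *)
Inductive atom : Type :=
  | Dep (xs : seq var) (y : var)
  | Const (ys : seq var)
  | Excl (xs ys : seq var)
  | Incl (xs ys : seq var)
  | Anon (xs : seq var) (y : var)
  | Indep (xs zs ys : seq var)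
  | Gen (n : nat) (C : iso_class n) (xs : n.-tuple var).

Definition wf_atom (al : atom) : bool :=
  match al with
  | Excl xs ys | Incl xs ys => (0 < size xs) && (size xs == size ys)
  | Anon xs _ => 0 < size xs
  | Indep xs _ ys => (0 < size xs) && (0 < size ys)
  | Dep _ _ | Const _ | Gen _ _ _ => true
  end.

Definition atom_vars (al : atom) : seq var :=
  match al with
  | Dep xs y | Anon xs y => rcons xs y
  | Const ys => ys
  | Excl xs ys | Incl xs ys => xs ++ ys
  | Indep xs zs ys => xs ++ zs ++ ys
  | Gen _ _ xs => xs
  end.

Inductive term (L : signature) : Type :=
  | Var (x : var)
  | App (f : fsym L) (ts : 'I_(far f) -> term L).

Inductive formula (L : signature) : Type :=
  | FEq (t u : term L)
  | FNeq (t u : term L)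
  | FRel (R : rsym L) (ts : 'I_(rar R) -> term L)
  | FNRel (R : rsym L) (ts : 'I_(rar R) -> term L)
  | FAtom (al : atom)
  | FAnd (phi psi : formula L)
  | FOr (phi psi : formula L)
  | FEx (x : var) (phi : formula L)
  | FAll (x : var) (phi : formula L)
  | FQuant (Q : lindstrom) (ys : (qar Q).-tuple var) (phi : formula L).

Fixpoint term_vars (L : signature) (t : term L) : seq var :=
  match t with
  | Var x => [:: x]
  | App f ts => flatten [seq term_vars (ts i) | i <- enum 'I_(far f)]
  end.

Fixpoint free_vars (L : signature) (phi : formula L) : seq var :=
  match phi with
  | FEq t u | FNeq t u => term_vars t ++ term_vars u
  | FRel R ts | FNRel R ts =>
      flatten [seq term_vars (ts i) | i <- enum 'I_(rar R)]
  | FAtom al => atom_vars al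
  | FAnd phi psi | FOr phi psi => free_vars phi ++ free_vars psi
  | FEx x phi | FAll x phi => [seq z <- free_vars phi | z != x]
  | FQuant Q ys phi => [seq z <- free_vars phi | z \notin ys]
  end.

(* Membership in the extension of first-order logic by the atoms in P and the
   Lindström quantifiers in QQ. *)
Fixpoint in_extension (L : signature) (P : atom -> Prop)
    (QQ : lindstrom -> Prop) (phi : formula L) : Prop :=
  match phi with
  | FEq _ _ | FNeq _ _ | FRel _ _ | FNRel _ _ => True
  | FAtom al => wf_atom al /\ P al
  | FAnd phi psi | FOr phi psi =>
      in_extension P QQ phi /\ in_extension P QQ psi
  | FEx _ phi | FAll _ phi => in_extension P QQ phi
  | FQuant Q ys phi => [/\ QQ Q, uniq ys & in_extension P QQ phi]
  end.

(* Assignments are genuinely partial, with finite domain: truth of a formula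
   with Lindström quantifiers is not local, i.e., it may depend on the values
   of variables in the domain of the team that are not free in the formula. *)
Definition assignment (A : Type) := {fmap var -> A}.

Definition team (A : Type) := set (assignment A).

Definition team_on (A : Type) (zs : seq var) (T : team A) : Prop :=
  forall s, T s -> domf s =i zs.

Definition vals (A : Type) (s : assignment A) (xs : seq var) : seq (option A) :=
  [seq s.[? x] | x <- xs].

Definition team_rel (A : Type) (n : nat) (T : team A) (xs : n.-tuple var) :
    set (n.-tuple A) :=
  [set b : n.-tuple A | exists2 s, T s & vals s xs = [seq Some a | a <- b]].

Definition update (A : Type) (n : nat) (s : assignment A)
    (ys : n.-tuple var) (b : n.-tuple A) : assignment A :=
  foldl (fun s p => s.[p.1 <- p.2]) s (zip ys b).

Definition supplement (A : Type) (T : team A) (F : assignment A -> set A)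
    (x : var) : team A :=
  [set s' | exists s a, [/\ T s, F s a & s' = s.[x <- a]]].

Definition supplement_tuple (A : Type) (n : nat) (T : team A)
    (F : assignment A -> set (n.-tuple A)) (ys : n.-tuple var) : team A :=
  [set s' | exists s b, [/\ T s, F s b & s' = update s ys b]].

(* term_val M s t a: the term t is defined under s and has value a. *)
Fixpoint term_val (L : signature) (M : model L) (s : assignment M)
    (t : term L) (a : M) : Prop :=
  match t with
  | Var x => s.[? x] = Some a
  | App f ts => exists2 b : (far f).-tuple M,
      forall i, term_val s (ts i) (tnth b i) & a = fun_int b
  end.

Definition atom_sat (A : Type) (T : team A) (al : atom) : Prop :=
  match al with
  | Dep xs y => forall s s', T s -> T s' ->
      vals s xs = vals s' xs -> s.[? y] = s'.[? y]
  | Const ys => forall s s', T s -> T s' -> vals s ys = vals s' ys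
  | Excl xs ys => forall s s', T s -> T s' -> vals s xs <> vals s' ys
  | Incl xs ys => forall s, T s -> exists2 s', T s' & vals s xs = vals s' ys
  | Anon xs y => forall s, T s ->
      exists s', [/\ T s', vals s xs = vals s' xs & s.[? y] <> s'.[? y]]
  | Indep xs zs ys => forall s s', T s -> T s' -> vals s zs = vals s' zs ->
      exists s'', [/\ T s'', vals s'' zs = vals s zs,
                      vals s'' xs = vals s xs & vals s'' ys = vals s' ys]
  | Gen n C xs => C A (team_rel T xs)
  end.

Fixpoint sat (L : signature) (M : model L) (T : team M) (phi : formula L) :
    Prop :=
  match phi with
  | FEq t u => forall s, T s ->
      exists2 a, term_val s t a & term_val s u a
  | FNeq t u => forall s, T s ->
      exists a b, [/\ term_val s t a, term_val s u b & a <> b]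
  | FRel R ts => forall s, T s ->
      exists2 b : (rar R).-tuple M,
        forall i, term_val s (ts i) (tnth b i) & rel_int b
  | FNRel R ts => forall s, T s ->
      exists2 b : (rar R).-tuple M,
        forall i, term_val s (ts i) (tnth b i) & ~ rel_int b
  | FAtom al => atom_sat T al
  | FAnd phi psi => sat T phi /\ sat T psi
  | FOr phi psi => exists U V : team M,
      [/\ T = U `|` V, sat U phi & sat V psi]
  | FEx x phi => exists F : assignment M -> set M,
      (forall s, T s -> F s !=set0) /\ sat (supplement T F x) phi
  | FAll x phi => sat (supplement T (fun=> [set: M]) x) phi
  | FQuant Q ys phi => exists F : assignment M -> set ((qar Q).-tuple M),
      sat (supplement_tuple T F ys) phi /\
      (forall s, T s -> qclass Q M (F s))
  end.

(* The vocabulary of the defining formula is L; the atom al uses none. *)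
Definition definable (L : signature) (P : atom -> Prop)
    (QQ : lindstrom -> Prop) (al : atom) : Prop :=
  exists phi : formula L,
    [/\ in_extension P QQ phi, {subset free_vars phi <= atom_vars al} &
        forall (M : model L) (T : team M), team_on (atom_vars al) T ->
          atom_sat T al <-> sat T phi].

Definition indep_arity (xs zs ys : seq var) : nat :=
  size zs + maxn (size xs) (size ys).

(* All atoms of arity less than k, and all constancy atoms. *)
Definition atoms_below (k : nat) (al : atom) : Prop :=
  match al with
  | Dep xs _ | Anon xs _ | Excl xs _ | Incl xs _ => size xs < k
  | Const _ => True
  | Indep xs zs ys => indep_arity xs zs ys < k
  | Gen n _ _ => n < k
  end.

(* As above, but with independence, exclusion, inclusion and anonymity atoms
   of arity k also allowed. *)
Definition atoms_dep (k : nat) (al : atom) : Prop :=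
  match al with
  | Dep xs _ => size xs < k
  | Anon xs _ | Excl xs _ | Incl xs _ => size xs <= k
  | Const _ => True
  | Indep xs zs ys => indep_arity xs zs ys <= k
  | Gen n _ _ => n < k
  end.

Definition all_lindstrom (Q : lindstrom) : Prop := True.

(* Main.v *)
Require Import Defs.
From mathcomp Require Import all_boot finmap classical_sets.
From mathcomp Require Import boolp zify.

Set Implicit Arguments.
Unset Strict Implicit.
Unset Printing Implicit Defensive.

Local Open Scope fmap_scope.
Local Open Scope classical_set_scope.

(** The proof bounds a dimension of the family of teams satisfying a formula.
    A family [P] of teams has upper dimension at most [c] when there are [c]
    teams [G i] such that every [T] in [P] lies below some [G i] for which the
    whole interval between [T] and [G i] is contained in [P] ([dominated]).

    Literals are flat, hence have dimension one.  If [P] and [Q] have dimension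
    at most [c] and [d], then their conjunction and disjunction have dimension at
    most [c * d], and applying a quantifier, Lindström or not, does not increase
    the dimension at all ([dominated_quant]): between two teams, a choice
    function for the smaller one can be prolonged by any admissible choice
    that remains inside [G i].  So if the atoms have dimension at most a fixed
    power of [b n] on structures of size about [n], then so does every formula
    ([dominated_formula]).

    With [N = n + 3], an exclusion, inclusion, anonymity or general atom of arity
    [j] has dimension at most [2 ^ (N ^ j)], and an independence atom at most the
    square of this, because the dominating team can be read off the relations
    that the team induces on its variables.  Dependence of arity [j] has
    dimension at most [N ^ (N ^ j)], the number of functions, and constancy of
    [l] variables at most [N ^ l] ([dominated_atom]).  Hence the formulas of (a)
    have dimension at most [(2 ^ (N ^ k)) ^ c], and those of (b)-(e) at most
    [(N ^ (N ^ k.-1)) ^ c], for a constant [c].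

    Conversely, if [T i] and [T j] are dominated by the same team, then the
    intervals from each of them to [T i `|` T j] consist of teams satisfying the
    formula.  For each of the atoms in question there is a large family of
    teams of which no two distinct members have this property: one team for
    each of the [n ^ (n ^ k)] functions in the case of dependence, and for each
    of the [2 ^ (n ^ k)] relations in the other cases.  For suitable [n]
    this exceeds the upper bound ([growth_dep], [growth_below]). *)

(** * Upper dimension of families of teams *)

(** [P] has upper dimension at most [c].  Neither the teams of [P] nor the [G i]
    are required to have a common domain of variables. *)
Definition dominated (A : Type) (c : nat) (P : team A -> Prop) : Prop :=
  exists (I : finType) (G : I -> team A), #|I| <= c /\
    forall T, P T -> exists i,
      T `<=` G i /\ forall T', T `<=` T' -> T' `<=` G i -> P T'.

Lemma dominated_leq (A : Type) (c d : nat) (P : team A -> Prop) :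
  c <= d -> dominated c P -> dominated d P.
Proof. by move=> cd [I [G [Ic GP]]]; exists I, G; split=> //; apply: leq_trans cd. Qed.

Lemma dominated_flat (A : Type) (p : assignment A -> Prop) :
  dominated 1 (fun T => forall s, T s -> p s).
Proof. by exists unit, (fun=> p); rewrite card_unit. Qed.

Lemma dominated_and (A : Type) (c d : nat) (P Q : team A -> Prop) :
  dominated c P -> dominated d Q -> dominated (c * d) (fun T => P T /\ Q T).
Proof.
move=> [I [G [Ic GP]]] [J [H [Jd HQ]]].
exists (I * J)%type, (fun ij => G ij.1 `&` H ij.2).
split=> [|T [/GP[i [TG GiP]] /HQ[j [TH HjQ]]]]; first by rewrite card_prod leq_mul.
exists (i, j) => /=; split=> [s Ts|T' TT' T'GH]; first by split; [apply: TG|apply: TH].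
by split; [apply: GiP|apply: HjQ] => // s /T'GH[].
Qed.

Lemma dominated_or (A : Type) (c d : nat) (P Q : team A -> Prop) :
  dominated c P -> dominated d Q ->
  dominated (c * d) (fun T => exists U V, [/\ T = U `|` V, P U & Q V]).
Proof.
move=> [I [G [Ic GP]]] [J [H [Jd HQ]]].
exists (I * J)%type, (fun ij => G ij.1 `|` H ij.2).
split=> [|_ [U [V [-> /GP[i [UG GiP]] /HQ[j [VH HjQ]]]]]].
  by rewrite card_prod leq_mul.
exists (i, j) => /=; split=> [s|T' UVT' T'GH].
  by case=> [/UG|/VH]; [left|right].
exists (T' `&` G i), (T' `&` H j); split.
- apply/seteqP; split=> s; last by case=> -[].
  by move=> T's; case: (T'GH _ T's) => ?; [left|right].
- apply: GiP => [s Us|s []//]; split; [by apply: UVT'; left|exact: UG].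
- apply: HjQ => [s Vs|s []//]; split; [by apply: UVT'; right|exact: VH].
Qed.

(** The shape shared by all the quantifiers: [upd s b] changes the assignment
    [s] by the value [b], and [K] is the condition imposed on the set of values
    chosen at each assignment. *)
Lemma dominated_quant (A B : Type) (c : nat) (P : team A -> Prop)
    (upd : assignment A -> B -> assignment A) (K : set B -> Prop) :
  dominated c P ->
  dominated c (fun T => exists F : assignment A -> set B,
    P [set s' | exists s b, [/\ T s, F s b & s' = upd s b]] /\
    forall s, T s -> K (F s)).
Proof.
move=> [I [G [Ic GP]]].
exists I, (fun i s => exists S, K S /\ forall b, S b -> G i (upd s b)).
split=> // T [F [/GP[i [TG GiP]] KF]]; exists i; split=> [s Ts|T' TT' T'G].
  by exists (F s); split=> [|b Fb]; [apply: KF|apply: TG; exists s, b].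
have /choice[F' F'P] : forall s, exists S : set B, (T s -> S = F s) /\
    (T' s -> K S /\ forall b, S b -> G i (upd s b)).
  move=> s; have [Ts|nTs] := pselect (T s).
    exists (F s); split=> // _; split=> [|b Fb]; first exact: KF.
    by apply: TG; exists s, b.
  by have [/T'G[S SP]|nT's] := pselect (T' s); [exists S|exists set0].
exists F'; split=> [|s /(F'P s).2[]//]; apply: GiP => [_|_] [s [b [Ts Fb ->]]].
  by exists s, b; split=> //; [apply: TT'|rewrite (F'P s).1].
exact: ((F'P s).2 Ts).2.
Qed.

(** * Upper dimension of the atoms *)

(** The relation that a team induces on [xs]; an entry is [None] where a variable
    is undefined. *)
Definition value_set (A : Type) (T : team A) (xs : seq var) :
  set (seq (option A)) := [set v | exists2 t, T t & vals t xs = v].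

Definition vals_tuple (A : Type) (s : assignment A) (xs : seq var) :
  (size xs).-tuple (option A) := map_tuple (fun x => s.[? x]) (in_tuple xs).

(** Over a finite structure, [value_set T xs] takes only finitely many values. *)
Lemma value_set_finite (A : finType) (xs : seq var) :
  exists (I : finType) (R : I -> set (seq (option A))),
    #|I| = 2 ^ (#|A|.+1 ^ size xs) /\
    forall T, exists i, R i = value_set T xs.
Proof.
pose I := {ffun (size xs).-tuple (option A) -> bool} : finType.
exists I, (fun (f : I) v => exists2 t, f t & tval t = v).
rewrite card_ffun card_bool card_tuple card_option; split=> // T.
exists [ffun t => `[< value_set T xs (tval t) >]].
apply/seteqP; split=> v; first by case=> t; rewrite ffunE => /asboolP ? <-.
case=> s Ts sv; exists (vals_tuple s xs) => //.
by rewrite ffunE; apply/asboolP; exists s.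
Qed.

(** A family of teams, each member [T] of which admits a dominating team that
    is determined by the relation [value_set T xs]. *)
Lemma dominated_value_set (A : finType) (xs : seq var) (P : team A -> Prop)
    (G : set (seq (option A)) -> team A) :
  (forall T, P T -> T `<=` G (value_set T xs) /\
     forall T', T `<=` T' -> T' `<=` G (value_set T xs) -> P T') ->
  dominated (2 ^ (#|A|.+1 ^ size xs)) P.
Proof.
move=> GP; have [I [R [cI RP]]] := value_set_finite A xs.
exists I, (G \o R); split=> [|T PT]; first by rewrite cI.
by have [i Ri] := RP T; exists i => /=; rewrite Ri; apply: GP.
Qed.

(** A bound on the upper dimension of an atom over a structure with [N - 1]
    elements, so that a variable has [N] possible values, one of them being
    undefined. *)
Definition atom_dim (N : nat) (al : atom) : nat :=
  match al with
  | Dep xs _ => N ^ (N ^ size xs)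
  | Const ys => N ^ size ys
  | Excl xs _ | Anon xs _ => 2 ^ (N ^ size xs)
  | Incl _ ys => 2 ^ (N ^ size ys)
  | Indep xs zs ys => 2 ^ (N ^ (size zs + size xs)) * 2 ^ (N ^ (size zs + size ys))
  | Gen n _ _ => 2 ^ (N ^ n)
  end.

Lemma vals_cat (A : Type) (s : assignment A) (xs ys : seq var) :
  vals s (xs ++ ys) = vals s xs ++ vals s ys.
Proof. exact: map_cat. Qed.

Lemma size_vals (A : Type) (s : assignment A) (xs : seq var) :
  size (vals s xs) = size xs.
Proof. exact: size_map. Qed.

Lemma cat_injl (T : Type) (a b c d : seq T) :
  size a = size c -> a ++ b = c ++ d -> a = c /\ b = d.
Proof. by elim: a c => [|x a IH] [|y c] //= [/IH h] [-> /h[-> ->]]. Qed.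

Lemma vals_cat_eq (A : Type) (s t u : assignment A) (xs ys : seq var) :
  vals s xs ++ vals t ys = vals u (xs ++ ys) ->
  vals s xs = vals u xs /\ vals t ys = vals u ys.
Proof. by rewrite vals_cat => /cat_injl; apply; rewrite !size_vals. Qed.

Lemma team_rel_value_set (A : Type) (n : nat) (T T' : team A)
    (xs : n.-tuple var) :
  value_set T xs = value_set T' xs -> team_rel T xs = team_rel T' xs.
Proof.
move=> e; suff h U : team_rel U xs = [set b | value_set U xs [seq Some a | a <- tval b]].
  by rewrite !h e.
by [].
Qed.

Lemma value_setS (A : Type) (T T' : team A) (xs : seq var) :
  T `<=` T' -> value_set T xs `<=` value_set T' xs.
Proof. by move=> TT' _ [t /TT' T't <-]; exists t. Qed.

Lemma dominated_atom (A : finType) (al : atom) :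
  dominated (atom_dim #|A|.+1 al) (fun T : team A => atom_sat T al).
Proof.
case: al => [xs y|ys|xs ys|xs ys|xs y|xs zs ys|n C xs] /=.
- pose I := {ffun (size xs).-tuple (option A) -> option A} : finType.
  exists I, (fun (f : I) (s : assignment A) => s.[? y] = f (vals_tuple s xs)).
  rewrite card_ffun card_tuple card_option; split=> // T dep.
  have /choice[f fP] : forall v : (size xs).-tuple (option A), exists a,
      forall s, T s -> vals s xs = v -> s.[? y] = a.
    move=> v.
    have [[s [Ts sv]]|nT] := pselect (exists s, T s /\ vals s xs = v).
      by exists s.[? y] => t Tt tv; apply: dep; rewrite // sv.
    (* The value [None] at unrealised tuples is arbitrary. *)
    by exists None => s Ts sv; case: nT; exists s.
  exists (finfun f); split=> [s Ts|T' _ T'f s s' /T'f -> /T'f -> e].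
    by rewrite ffunE; apply: fP.
  by congr (_ _); apply: val_inj.
- exists ((size ys).-tuple (option A)), (fun v (s : assignment A) => vals s ys = tval v).
  rewrite card_tuple card_option; split=> // T cst.
  have [[t Tt]|nT] := pselect (exists t, T t); last first.
    exists [tuple of nseq (size ys) None]; split=> [s Ts|T' _ T'v s s' /T'v -> /T'v -> //].
    by case: nT; exists s.
  exists (vals_tuple t ys); split=> [s Ts|T' _ T'v s s' /T'v -> /T'v -> //].
  exact: cst.
- apply: (dominated_value_set
    (G := fun R s => R (vals s xs) /\ ~ R (vals s ys))) => T ex.
  split=> [s Ts|T' _ T'G s s' /T'G[Rs _] /T'G[_ nRs'] e].
    by split; [exists s|case=> t Tt; exact: ex t s Tt Ts].
  by apply: nRs'; rewrite -e.
- apply: (dominated_value_set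
    (G := fun R s => R (vals s xs) /\ R (vals s ys))) => T inc.
  split=> [s Ts|T' TT' T'G s /T'G[[t Tt <-] _]].
    by split; [have [t Tt ->] := inc s Ts; exists t|exists s].
  by exists t; first exact: TT'.
- apply: (dominated_value_set (G := fun R s => R (vals s xs))) => T an.
  split=> [s Ts|T' TT' T'G s /T'G[t Tt ts]]; first by exists s.
  (* Of the two values of [y] realised in [T] over the value of [xs] at [s],
     at least one differs from the value of [y] at [s]. *)
  have [t' [Tt' tt' ntt']] := an t Tt.
  have [st|st] := pselect (s.[? y] = t.[? y]).
    by exists t'; rewrite -ts st; split=> //; apply: TT'.
  by exists t; split=> //; apply: TT'.
- have [I [R [cI RP]]] := value_set_finite A (zs ++ xs).
  have [J [S [cJ SP]]] := value_set_finite A (zs ++ ys).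
  exists (I * J)%type.
  exists (fun ij s => R ij.1 (vals s (zs ++ xs)) /\ S ij.2 (vals s (zs ++ ys))).
  split=> [|T ind]; first by rewrite card_prod cI cJ !size_cat.
  have [i Ri] := RP T; have [j Sj] := SP T; exists (i, j); rewrite /= Ri Sj.
  split=> [s Ts|T' TT' T'G s s']; first by split; exists s.
  move=> /T'G[[t Tt ts] _] /T'G[_ [t' Tt' ts']] e.
  move: ts ts'; rewrite [in LHS]vals_cat => /vals_cat_eq[tz tx].
  rewrite [in LHS]vals_cat => /vals_cat_eq[t'z t'y].
  have [|u [Tu uz ux uy]] := ind t t' Tt Tt'; first by rewrite tz t'z.
  by exists u; rewrite uz ux uy; split=> //; apply: TT'.
- have -> : 2 ^ #|A|.+1 ^ n = 2 ^ #|A|.+1 ^ size xs by rewrite size_tuple.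
  apply: (dominated_value_set (G := fun R s => R (vals s xs))) => T gen.
  split=> [s Ts|T' TT' T'G]; first by exists s.
  rewrite -(@team_rel_value_set _ _ T) //; apply/seteqP.
  by split; [apply: value_setS|move=> _ [s /T'G ? <-]].
Qed.

(** * Upper dimension of formulas *)

(** A set of size [n + 2], with two distinguished elements [None] and
    [Some None]. *)
Definition dom (n : nat) : finType := option (option 'I_n).

Lemma card_dom (n : nat) : #|dom n| = n.+2.
Proof. by rewrite !card_option card_ord. Qed.

(** The structure on [dom n] in which every function is constant and every
    relation is empty; the interpretation of the vocabulary plays no role. *)
Definition std_model (L : signature) (n : nat) : model L.
Proof.
refine (@Model L (dom n) (fun _ _ => None) (fun _ => set0) _).
by exists None, (Some None).
Defined.

(** If the allowed atoms have dimension bounded by powers of [b], so do all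
    formulas. *)
Lemma dominated_formula (L : signature) (P : atom -> Prop)
    (QQ : lindstrom -> Prop) (b : nat -> nat) :
  (forall n, 0 < b n) ->
  (forall al, wf_atom al -> P al -> exists c, forall n, atom_dim n.+3 al <= b n ^ c) ->
  forall phi : formula L, in_extension P QQ phi ->
  exists c, forall n,
    dominated (b n ^ c) (fun T : team (std_model L n) => sat T phi).
Proof.
move=> b_gt0 Pb.
elim=> [t u|t u|R ts|R ts|al|phi IH psi IH'|phi IH psi IH'|x phi IH|x phi IH|Q ys phi IH] /=.
- by move=> _; exists 0 => n; apply: dominated_flat.
- by move=> _; exists 0 => n; apply: dominated_flat.
- by move=> _; exists 0 => n; apply: dominated_flat.
- by move=> _; exists 0 => n; apply: dominated_flat.
- move=> [wf /(Pb _ wf)[c bc]]; exists c => n; apply: dominated_leq (bc n) _.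
  by have := dominated_atom (dom n) al; rewrite card_dom.
- move=> [/IH[c Hc] /IH'[d Hd]]; exists (c + d) => n.
  by rewrite expnD; exact: dominated_and (Hc n) (Hd n).
- move=> [/IH[c Hc] /IH'[d Hd]]; exists (c + d) => n.
  by rewrite expnD; exact: dominated_or (Hc n) (Hd n).
- move=> /IH[c Hc]; exists c => n.
  have := dominated_quant (fun s (a : dom n) => s.[x <- a]) nonempty (Hc n).
  congr dominated; apply: funext => T; apply/propext.
  by split=> -[F [? ?]]; exists F; split.
- move=> /IH[c Hc]; exists c => n.
  (* The universal quantifier is the case where only the full set may be chosen. *)
  have := dominated_quant (fun s (a : dom n) => s.[x <- a]) (fun S => S = setT) (Hc n).
  congr dominated; apply: funext => T; apply/propext; split=> [[F [PF FT]]|HT].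
    congr (sat _ _): PF; apply/seteqP; split=> _ [s [a [Ts Fa ->]]]; exists s, a; split=> //.
    by rewrite FT.
  by exists (fun=> setT).
- move=> [_ _ /IH[c Hc]]; exists c => n.
  exact: (dominated_quant (fun s a => update s ys a) (@in_class _ (qclass Q) (dom n)) (Hc n)).
Qed.

(** If the atom [al] is definable, then a family of teams satisfying it is small
    as soon as no two distinct members [T i] and [T j] can be dominated by the
    same team, which would have to include [T i `|` T j]. *)
Lemma definable_card (L : signature) (P : atom -> Prop)
    (QQ : lindstrom -> Prop) (b : nat -> nat) (al : atom) :
  (forall n, 0 < b n) ->
  (forall al', wf_atom al' -> P al' ->
    exists c, forall n, atom_dim n.+3 al' <= b n ^ c) ->
  definable L P QQ al ->
  exists c, forall n (I : finType) (T : I -> team (dom n)),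
    (forall i, team_on (atom_vars al) (T i)) ->
    (forall i, atom_sat (T i) al) ->
    (forall i j,
      (forall T', T i `<=` T' -> T' `<=` T i `|` T j -> atom_sat T' al) ->
      (forall T', T j `<=` T' -> T' `<=` T i `|` T j -> atom_sat T' al) ->
      i = j) ->
    #|I| <= b n ^ c.
Proof.
move=> b_gt0 Pb [phi [/(dominated_formula b_gt0 Pb)[c Hc] _ phiP]].
exists c => n I T Ton Tal Tsep.
have [J [G [Jc GP]]] := Hc n.
have /choice[g gP] i := GP (T i) ((phiP (std_model L n) _ (Ton i)).1 (Tal i)).
apply: leq_trans Jc; apply: (leq_card g) => i j gij.
have UG : T i `|` T j `<=` G (g i).
  by move=> s [/(gP i).1|/(gP j).1]; rewrite // gij.
have Uon T' : T' `<=` T i `|` T j -> team_on (atom_vars al) T'.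
  by move=> T'U s /T'U[]; apply: Ton.
apply: Tsep => T' TT' T'U; apply: (phiP (std_model L n) _ (Uon _ T'U)).2.
  by apply: (gP i).2 => // s /T'U/UG.
by apply: (gP j).2 => // s /T'U/UG; rewrite gij.
Qed.

(** * Comparison of growth rates *)

Lemma leq_expl (m n e : nat) : m <= n -> m ^ e <= n ^ e.
Proof. by case: e => // e; rewrite leq_exp2r. Qed.

Lemma atom_dim_below (k : nat) (al : atom) :
  0 < k -> wf_atom al -> atoms_below k al ->
  exists c, forall n, atom_dim n.+3 al <= (n.+3 ^ (n.+3 ^ k.-1)) ^ c.
Proof.
move=> k_gt0; have le1 n j l : 1 < l -> l <= n.+3 -> j < k ->
    l ^ (n.+3 ^ j) <= n.+3 ^ (n.+3 ^ k.-1).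
  move=> l1 ln jk; apply: (@leq_trans (n.+3 ^ (n.+3 ^ j))).
    by rewrite leq_exp2r // expn_gt0.
  by rewrite leq_exp2l // leq_exp2l // -ltnS prednK.
case: al => [xs y|ys|xs ys|xs ys|xs y|xs zs ys|m C xs] /= wf al_k;
  try by exists 1 => n; rewrite expn1 le1.
- by exists (size ys) => n; rewrite -expnM leq_exp2l // leq_pmull // expn_gt0.
- by move: wf al_k => /andP[_ /eqP->] al_k; exists 1 => n; rewrite expn1 le1.
- exists 2 => n; rewrite expnS expn1 leq_mul // le1 //; rewrite /indep_arity in al_k; lia.
Qed.

Lemma atom_dim_dep (k : nat) (al : atom) :
  0 < k -> wf_atom al -> atoms_dep k al ->
  exists c, forall n, atom_dim n.+3 al <= (2 ^ (n.+3 ^ k)) ^ c.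
Proof.
move=> k_gt0.
have le1 n j : j <= k -> 2 ^ (n.+3 ^ j) <= 2 ^ (n.+3 ^ k).
  by move=> jk; rewrite leq_exp2l // leq_exp2l.
have le2 n j : n.+3 ^ j <= 2 ^ (n.+3 * j).
  by rewrite expnM leq_expl // ltnW // ltn_expl.
case: al => [xs y|ys|xs ys|xs ys|xs y|xs zs ys|m C xs] /= wf al_k;
  try by exists 1 => n; rewrite expn1 le1 // ltnW.
- exists 1 => n; rewrite expn1; apply: leq_trans (le2 _ _) _.
  by rewrite -expnS le1.
- exists (size ys) => n; apply: leq_trans (le2 _ _) _.
  rewrite -expnM leq_exp2l // leq_mul // -[leqLHS]expn1 leq_exp2l //.
- by move: wf al_k => /andP[_ /eqP->] al_k; exists 1 => n; rewrite expn1 le1.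
- exists 2 => n; rewrite expnS expn1 leq_mul // le1 //; rewrite /indep_arity in al_k; lia.
Qed.

Lemma growth_below (k c : nat) : 0 < k ->
  exists n, (n.+3 ^ (n.+3 ^ k.-1)) ^ c < 2 ^ (n ^ k).
Proof.
case: k => // k _ /=; pose C := c * 2 ^ k.
(* With [n = 2 ^ m] the inequality reduces to [m.+1 * C < 2 ^ m]. *)
pose m := 2 * C + 4; exists (2 ^ m).
have n3 : (2 ^ m).+3 <= 2 ^ m.+1.
  rewrite expnS; have : 2 ^ 4 <= 2 ^ m by rewrite leq_exp2l // /m leq_addl.
  by lia.
have e : (2 ^ m).+3 ^ k <= 2 ^ k * (2 ^ m) ^ k.
  by rewrite -expnMn -expnS leq_expl.
apply: (@leq_ltn_trans (2 ^ (m.+1 * ((2 ^ m).+3 ^ k * c)))).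
  rewrite -expnM [X in _ <= X]expnM.
  exact: leq_expl.
rewrite ltn_exp2l //.
have : m.+1 * ((2 ^ m).+3 ^ k * c) <= m.+1 * C * (2 ^ m) ^ k.
  by rewrite -mulnA leq_mul // /C; nia.
move/leq_ltn_trans; apply; rewrite [X in _ < X]expnS ltn_pmul2r ?expn_gt0 //.
have C2 : C < 2 ^ C by apply: ltn_expl.
have -> : 2 ^ m = 2 ^ C * 2 ^ C * 16 by rewrite /m expnD mul2n -addnn expnD.
by rewrite /m; nia.
Qed.

Lemma growth_dep (k c : nat) :
  exists n, (2 ^ (n.+3 ^ k)) ^ c < n ^ (n ^ k).
Proof.
(* With [n = 2 ^ m] the inequality reduces to [c * 2 ^ k < m]. *)
pose m := c * 2 ^ k + 2; exists (2 ^ m).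
have n3 : (2 ^ m).+3 <= 2 ^ m.+1.
  rewrite expnS; have : 2 ^ 2 <= 2 ^ m by rewrite leq_exp2l // /m leq_addl.
  by lia.
have e : (2 ^ m).+3 ^ k <= 2 ^ k * (2 ^ m) ^ k.
  by rewrite -expnMn -expnS leq_expl.
have B_gt0 : 0 < (2 ^ m) ^ k by rewrite !expn_gt0.
move: e B_gt0; move: ((2 ^ m).+3 ^ k) ((2 ^ m) ^ k) => A B AB B_gt0.
by rewrite -!expnM ltn_exp2l // /m; nia.
Qed.

(** * Families of teams that force a large dimension *)

Lemma exists_vals (A : Type) (zs : seq var) (b : seq A) :
  uniq zs -> size b = size zs ->
  exists2 s : assignment A, domf s =i zs & vals s zs = map Some b.
Proof.
elim: zs b => [|z zs IH] [|a b] //= => [_ _|/andP[zzs uzs] [/(IH _ uzs)[s sd sb]]].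
  by exists [fmap].
exists s.[z <- a] => [x|]; first by rewrite dom_setf !inE sd.
rewrite fnd_set eqxx -sb; congr (_ :: _); apply/eq_in_map => x xzs.
by rewrite fnd_set; case: eqP => // xz; rewrite -xz xzs in zzs.
Qed.

Lemma exists_vals_cat (A : Type) (xs ys : seq var) (a b : seq A) :
  uniq (xs ++ ys) -> size a = size xs -> size b = size ys ->
  exists s : assignment A,
    [/\ domf s =i xs ++ ys, vals s xs = map Some a & vals s ys = map Some b].
Proof.
move=> u sa sb; have [|s sd] := @exists_vals A (xs ++ ys) (a ++ b) u.
  by rewrite !size_cat sa sb.
rewrite map_cat vals_cat => /cat_injl[|? ?]; first by rewrite size_vals size_map.
by exists s.
Qed.

Lemma vals_defined (A : Type) (s : assignment A) (zs xs : seq var) :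
  domf s =i zs -> {subset xs <= zs} ->
  exists2 a : seq A, size a = size xs & vals s xs = map Some a.
Proof.
move=> sd; elim: xs => [|x xs IH] xszs; first by exists [::].
have [|a sa xa] := IH; first by move=> y yxs; apply: xszs; rewrite inE yxs orbT.
have xs_dom : x \in domf s by rewrite sd xszs // inE eqxx.
exists (s.[xs_dom] :: a); rewrite /= ?sa //.
by rewrite -/(vals s xs) xa in_fnd.
Qed.

(** Tuples of undistinguished elements, which are copies of the elements of
    ['I_n]. *)
Definition code (n : nat) (v : seq 'I_n) : seq (dom n) :=
  [seq Some (Some i) | i <- v].

(** A relation of arity [k] over the undistinguished elements. *)
Definition relation (k n : nat) : finType := {ffun k.-tuple 'I_n -> bool}.

(** The relation [R], as a set of tuples of values of variables. *)
Definition rel_codes (k n : nat) (R : relation k n) : set (seq (option (dom n))) :=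
  [set w | exists2 v, R v & w = map Some (code (tval v))].

Lemma rel_codesE (k n : nat) (R : relation k n) (v : k.-tuple 'I_n) :
  rel_codes R (map Some (code v)) <-> R v.
Proof.
split=> [[u Ru e]|Rv]; last by exists v.
suff -> : v = u by [].
by apply: val_inj; move: e => /(inj_map (@Some_inj _))/(inj_map _); apply=> i j [].
Qed.

(** The constant tuples formed from the two distinguished elements. *)
Definition const0 (n k : nat) : seq (dom n) := nseq k None.
Definition const1 (n k : nat) : seq (dom n) := nseq k (Some None).

Lemma code_const0 (n k : nat) (v : k.-tuple 'I_n) :
  0 < k -> code v <> const0 n k.
Proof. by case: k v => // k v _; rewrite (tuple_eta v). Qed.

Lemma rel_codes_const0 (k n : nat) (R : relation k n) :
  0 < k -> ~ rel_codes R (map Some (const0 n k)).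
Proof. by move=> k0 [v _ /(inj_map (@Some_inj _))/esym/(code_const0 k0)]. Qed.

Lemma rel_codes_const1 (k n : nat) (R : relation k n) :
  0 < k -> ~ rel_codes R (map Some (const1 n k)).
Proof.
by case: k R => // k R _ [v _ /(inj_map (@Some_inj _))]; rewrite (tuple_eta v).
Qed.

Lemma size_code (n k : nat) (v : k.-tuple 'I_n) : size (code v) = k.
Proof. by rewrite size_map size_tuple. Qed.

(** The lower bound needed in (b)-(e): a family of teams indexed by the relations
    of arity [k], such that [R] can be shown to be included in [R'] whenever all
    teams between [T R'] and [T R `|` T R'] satisfy the atom. *)
Lemma not_definable_below (L : signature) (k : nat) (al : atom)
    (T : forall n, relation k n -> team (dom n)) :
  0 < k ->
  (forall n R, team_on (atom_vars al) (@T n R)) ->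
  (forall n R, atom_sat (@T n R) al) ->
  (forall n (R R' : relation k n),
    (forall T', T n R' `<=` T' -> T' `<=` T n R `|` T n R' -> atom_sat T' al) ->
    forall v, R v -> R' v) ->
  ~ definable L (atoms_below k) all_lindstrom al.
Proof.
move=> k_gt0 Ton Tal Tsep.
have b_gt0 n : 0 < n.+3 ^ (n.+3 ^ k.-1) by rewrite expn_gt0.
case/(definable_card b_gt0 (fun al' => @atom_dim_below k al' k_gt0)) => c Hc.
have [n] := growth_below c k_gt0; rewrite ltnNge => /negP; apply.
have -> : 2 ^ (n ^ k) = #|relation k n|.
  by rewrite card_ffun card_bool card_tuple card_ord.
apply: (Hc n (relation k n) (T n)) => // R R' RP R'P.
apply/ffunP => v; apply/idP/idP; first exact: Tsep.
by apply: Tsep => T' ? T'U; apply: RP => // s /T'U; rewrite setUC.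
Qed.

(** The team of a function [f] is its graph; the union of two distinct graphs
    violates dependence. *)
Lemma not_definable_dep (L : signature) (k : nat) (xs : seq var) (y : var) :
  0 < k -> size xs = k -> uniq (rcons xs y) ->
  ~ definable L (atoms_dep k) all_lindstrom (Dep xs y).
Proof.
move=> k_gt0 sxs uxy.
have b_gt0 n : 0 < 2 ^ (n.+3 ^ k) by rewrite expn_gt0.
case/(definable_card b_gt0 (fun al' => @atom_dim_dep k al' k_gt0)) => c Hc.
have [n] := growth_dep k c; rewrite ltnNge => /negP; apply.
pose I : finType := {ffun k.-tuple 'I_n -> 'I_n}.
pose T (f : I) : team (dom n) := fun s => domf s =i rcons xs y /\
  exists2 v : k.-tuple 'I_n, vals s xs = map Some (code v) &
    s.[? y] = Some (Some (Some (f v))).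
have -> : n ^ (n ^ k) = #|I| by rewrite card_ffun card_tuple !card_ord.
apply: (Hc n I T) => [f s []//|f s s' [_ [v sv sy]] [_ [v' sv' sy']]|f g fP _].
  rewrite sv sv' sy sy' => /(inj_map (@Some_inj _))/(inj_map _) vv'.
  by have -> : v = v' by apply: val_inj; apply: vv' => i j [].
have dep := fP (T f `|` T g) (@subsetUl _ _ _) (fun _ => id).
apply/ffunP => v; move: (uxy); rewrite -cats1 => uxy'.
have ex (a : 'I_n) : exists s : assignment (dom n),
    [/\ domf s =i rcons xs y, vals s xs = map Some (code v) &
        s.[? y] = Some (Some (Some a))].
  have [||s [sd sx [sy]]] :=
    @exists_vals_cat (dom n) xs [:: y] (code v) [:: Some (Some a)] uxy'.
  - by rewrite size_code.
  - by [].
  by exists s; split; rewrite -?cats1.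
have [s [sd sx sy]] := ex (f v); have [s' [sd' sx' sy']] := ex (g v).
have := dep s s'; rewrite sx sx' sy sy' => /(_ _ _ erefl) H.
suff : Some (Some (Some (f v))) = Some (Some (Some (g v))) by case.
by apply: H; [left|right]; split=> //; exists v.
Qed.

(** In the team of [R], [xs] ranges over [R] together with a constant tuple and
    [ys] over the complement of that union.  If [v] lies in [R] but not in [R'], then [v] is a
    value of [xs] in one team and of [ys] in the other. *)
Lemma not_definable_excl (L : signature) (k : nat) (xs ys : seq var) :
  0 < k -> size xs = k -> size ys = k -> uniq (xs ++ ys) ->
  ~ definable L (atoms_below k) all_lindstrom (Excl xs ys).
Proof.
move=> k_gt0 sx sy u.
pose C n (R : relation k n) := rel_codes R `|` [set map Some (const0 n k)].
apply: (not_definable_below (T := fun n R s =>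
  [/\ domf s =i xs ++ ys, C n R (vals s xs) & ~ C n R (vals s ys)])) => //.
- by move=> n R s [].
- by move=> n R s s' [_ Rs _] [_ _ nRs'] e; apply: nRs'; rewrite -e.
move=> n R R' /(_ _ (@subsetUr _ _ _) (fun _ => id)) ex v Rv.
apply: contrapT => nR'v.
have [||s [sd sxv syv]] := exists_vals_cat (a := code v) (b := const1 n k) u.
- by rewrite size_code.
- by rewrite size_nseq.
have [||s' [sd' sxv' syv']] := exists_vals_cat (a := const0 n k) (b := code v) u.
- by rewrite size_nseq.
- by rewrite size_code.
apply: (ex s s'); last by rewrite sxv syv'.
- left; split=> //; first by left; rewrite sxv; apply/rel_codesE.
  rewrite syv => -[/(rel_codes_const1 k_gt0)//|/(inj_map (@Some_inj _))].
  by case: (k) k_gt0.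
- right; split=> //; first by right; rewrite sxv'.
  rewrite syv' => -[/rel_codesE//|/(inj_map (@Some_inj _))].
  exact: code_const0.
Qed.

(** In the team of [R], both [xs] and [ys] range over [R] together with a
    constant tuple.  Adding to the team of [R'] an assignment that sends [xs] to [v]
    and [ys] to the constant tuple violates inclusion unless [R'] contains
    [v]. *)
Lemma not_definable_incl (L : signature) (k : nat) (xs ys : seq var) :
  0 < k -> size xs = k -> size ys = k -> uniq (xs ++ ys) ->
  ~ definable L (atoms_below k) all_lindstrom (Incl xs ys).
Proof.
move=> k_gt0 sx sy u.
pose C n (R : relation k n) := rel_codes R `|` [set map Some (const0 n k)].
apply: (not_definable_below (T := fun n R s =>
  [/\ domf s =i xs ++ ys, C n R (vals s xs) & C n R (vals s ys)])) => //.
- by move=> n R s [].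
- move=> n R s [sd Rsx Rsy].
  have [a sa xa] := vals_defined sd (fun x => mem_subseq (prefix_subseq xs ys) (x := x)).
  have [||s' [sd' sx' sy']] := exists_vals_cat (a := const0 n k) (b := a) u.
  + by rewrite size_nseq.
  + by rewrite sa sx.
  exists s'; last by rewrite xa sy'.
  by split=> //; [right; rewrite sx'|rewrite sy' -xa].
move=> n R R' inc v Rv.
have [||s [sd sxv syv]] := exists_vals_cat (a := code v) (b := const0 n k) u.
- by rewrite size_code.
- by rewrite size_nseq.
have Ts : C n R (vals s xs) /\ C n R (vals s ys).
  by split; [left; rewrite sxv; apply/rel_codesE|right; rewrite syv].
have := inc (_ `|` [set s]) (@subsetUl _ _ _).
case/(_ _ s (or_intror erefl)) => [t [Tt|->]|t]; first by right.
  by left; case: Ts.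
case=> [[_ _ Cty]|-> {t}]; rewrite sxv => e.
  move: Cty; rewrite -e => -[/rel_codesE//|/(inj_map (@Some_inj _))].
  by move/(code_const0 k_gt0).
by move: e; rewrite syv => /(inj_map (@Some_inj _))/(code_const0 k_gt0).
Qed.

(** In the team of [R], [xs] ranges over [R] and [y] is arbitrary.  An assignment
    added to the team of [R'] with a value of [xs] outside [R'] would be the only
    one with that value, violating anonymity. *)
Lemma not_definable_anon (L : signature) (k : nat) (xs : seq var) (y : var) :
  0 < k -> size xs = k -> uniq (rcons xs y) ->
  ~ definable L (atoms_below k) all_lindstrom (Anon xs y).
Proof.
move=> k_gt0 sx; rewrite -cats1 => u.
apply: (not_definable_below (T := fun n R s =>
  domf s =i xs ++ [:: y] /\ rel_codes R (vals s xs))) => //.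
- by move=> n R s [sd _] x; rewrite sd cats1.
- move=> n R s [sd [v Rv sv]].
  have y_val (a : dom n) : exists s' : assignment (dom n),
      [/\ domf s' =i xs ++ [:: y], vals s' xs = map Some (code v) & s'.[? y] = Some a].
    have [||s' [sd' sx' [sy']]] := exists_vals_cat (a := code v) (b := [:: a]) u.
    + by rewrite size_code.
    + by [].
    by exists s'.
  have T_val s' : domf s' =i xs ++ [:: y] -> vals s' xs = map Some (code v) ->
      domf s' =i xs ++ [:: y] /\ rel_codes R (vals s' xs).
    by move=> ? ->; split=> //; exists v.
  have [t [td tx ty]] := y_val None; have [t' [td' tx' ty']] := y_val (Some None).
  have [sy|sy] := pselect (s.[? y] = t.[? y]).
    by exists t'; split; [exact: T_val|rewrite sv tx'|rewrite sy ty ty'].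
  by exists t; split; [exact: T_val|rewrite sv tx|].
move=> n R R' an v Rv.
have [||s [sd sxv [sy]]] := exists_vals_cat (a := code v) (b := [:: None]) u.
- by rewrite size_code.
- by [].
have := an (_ `|` [set s]) (@subsetUl _ _ _).
case/(_ _ s (or_intror erefl)) => [t [Tt|->]|t []]; first by right.
  by left; split=> //; rewrite sxv; exists v.
case=> [[_ Rt]|->]; last by [].
by move=> e _; apply/rel_codesE; rewrite -sxv e.
Qed.

(** Independence is symmetric in its outer arguments, which allows one to assume
    that [xs] is at least as long as [ys]. *)
Lemma definable_indepC (L : signature) (P : atom -> Prop)
    (QQ : lindstrom -> Prop) (xs zs ys : seq var) :
  definable L P QQ (Indep xs zs ys) -> definable L P QQ (Indep ys zs xs).
Proof.
have mem_sym : xs ++ zs ++ ys =i ys ++ zs ++ xs.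
  by move=> x; rewrite !mem_cat; do 3 case: (_ \in _).
move=> [phi [Pphi fv phiP]]; exists phi; split=> //= [x /fv|M T Ton].
  by rewrite /= mem_sym.
rewrite -phiP => [|s /Ton sd x]; last by rewrite sd mem_sym.
split=> ind s s' Ts Ts' e.
  by have [t [Tt tz ty tx]] := ind s' s Ts' Ts (esym e); exists t; rewrite tz e.
by have [t [Tt tz tx ty]] := ind s' s Ts' Ts (esym e); exists t; rewrite tz e.
Qed.

(** In the team of [R], the tuple [xs ++ zs] lies in [R] or [xs] takes a constant
    value, and [ys] is arbitrary.  Given [v] in [R], add to the team of [R'] an
    assignment [s] sending [xs ++ zs] to [v].  The team of [R'] contains an
    assignment [s'] that agrees with [s] on [zs] and is constant on [xs],
    with another value of [ys]; independence of [s] and [s'] forces an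
    assignment of the team of [R'] to agree with [s] on [xs ++ zs]. *)
Lemma not_definable_indep (L : signature) (k : nat) (xs zs ys : seq var) :
  0 < size xs -> 0 < size ys -> size zs + size xs = k ->
  uniq (xs ++ zs ++ ys) ->
  ~ definable L (atoms_below k) all_lindstrom (Indep xs zs ys).
Proof.
move=> x_gt0 y_gt0 szx u.
have k_gt0 : 0 < k by rewrite -szx addn_gt0 x_gt0 orbT.
have u' : uniq ((xs ++ zs) ++ ys) by rewrite -catA.
pose C n (R : relation k n) (s : assignment (dom n)) :=
  rel_codes R (vals s (xs ++ zs)) \/ vals s xs = map Some (const0 n (size xs)).
apply: (not_definable_below (T := fun n R s =>
  domf s =i xs ++ zs ++ ys /\ C n R s)) => //.
- by move=> n R s [].
- move=> n R s s' [sd Cs] [sd' _] e.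
  have [|a sa xa] := vals_defined (xs := xs ++ zs) sd.
    by move=> x xin; rewrite catA mem_cat xin.
  have [|b sb yb] := vals_defined (xs := ys) sd'.
    by move=> x xin; rewrite catA mem_cat xin orbT.
  have [t [td tx ty]] := exists_vals_cat u' sa sb.
  move: (tx); rewrite -xa [in LHS]vals_cat => /vals_cat_eq[sx sz].
  rewrite -catA in td; exists t; split=> //; last by rewrite ty.
  by split=> //; rewrite /C tx -xa sx.
move=> n R R' ind v Rv.
have sv : size (code v) = size (xs ++ zs) by rewrite size_code size_cat addnC.
have s0 m (a : dom n) : size (nseq m a) = m by rewrite size_nseq.
have [s [sd sxz sy]] := exists_vals_cat u' sv (s0 (size ys) None).
rewrite -catA in sd.
move: (sxz); rewrite -[code v](cat_take_drop (size xs)) map_cat vals_cat.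
have stake : size (take (size xs) (code v)) = size xs.
  by rewrite size_takel // sv size_cat leq_addr.
case/cat_injl => [|sx sz]; first by rewrite size_vals size_map stake.
have [|s' [sd']] := exists_vals_cat
  (b := drop (size xs) (code v) ++ nseq (size ys) (Some None)) u (s0 (size xs) None).
  by rewrite !size_cat size_nseq size_drop sv size_cat addKn.
rewrite map_cat -sz vals_cat => sx'.
case/cat_injl => [|sz' sy']; first by rewrite !size_vals.
have := ind (_ `|` [set s]) (@subsetUl _ _ _).
case/(_ _ s s' (or_intror erefl)) => [t [Tt|->]||//|t [Tt tz tx ty]].
- by right.
- by left; split=> //; left; rewrite sxz; exists v.
- by left; split=> //; right.
have {}Tt : C n R' t.
  case: Tt => [[]//|ts]; move: ty; rewrite ts sy sy'.
  by case: (ys) y_gt0.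
case: Tt => [|]; first by rewrite vals_cat tx tz -vals_cat sxz => /rel_codesE.
rewrite tx sx => /(inj_map (@Some_inj _)).
by case: (xs) x_gt0 sv => // x xs' _; case: (tval v).
Qed.

(** * Undefinability *)

Theorem theorem5p9 (L : signature) (k : nat) (k_gt0 : 0 < k) :
  [/\ (forall (xs : seq var) (y : var),
         size xs = k -> uniq (rcons xs y) ->
         ~ definable L (atoms_dep k) all_lindstrom (Dep xs y)),
      (forall xs ys : seq var,
         size xs = k -> size ys = k -> uniq (xs ++ ys) ->
         ~ definable L (atoms_below k) all_lindstrom (Excl xs ys)),
      (forall xs ys : seq var,
         size xs = k -> size ys = k -> uniq (xs ++ ys) ->
         ~ definable L (atoms_below k) all_lindstrom (Incl xs ys)),
      (forall (xs : seq var) (y : var),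
         size xs = k -> uniq (rcons xs y) ->
         ~ definable L (atoms_below k) all_lindstrom (Anon xs y)) &
      (forall xs zs ys : seq var,
         0 < size xs -> 0 < size ys -> indep_arity xs zs ys = k ->
         uniq (xs ++ zs ++ ys) ->
         ~ definable L (atoms_below k) all_lindstrom (Indep xs zs ys))].
Proof.
split=> [xs y|xs ys|xs ys|xs y|xs zs ys x_gt0 y_gt0].
- exact: not_definable_dep.
- exact: not_definable_excl.
- exact: not_definable_incl.
- exact: not_definable_anon.
rewrite /indep_arity => ar u; have [yx|xy] := leqP (size ys) (size xs).
  by apply: not_definable_indep => //; rewrite -ar (maxn_idPl yx).
move/definable_indepC; apply: not_definable_indep => //.
  by rewrite -ar (maxn_idPr (ltnW xy)).
by move: u; rewrite uniq_catC -catA uniq_catCA.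
Qed.
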